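(* Let $G$ be a finite group. If $T(G)>\sqrt{3/8}\,|G|$, then $G$ is abelian, or isoclinic to a $2$-group, or isoclinic to a $3$-group, or isoclinic to $\mathrm{S}_3$, or isoclinic to $D_{10}$.
   Context: For a finite group $G$, $\mathrm{Irr}(G)$ denotes the set of irreducible complex characters of $G$, and $T(G)=\sum_{\chi\in\mathrm{Irr}(G)}\chi(1)$ is the sum of their degrees. Two groups $G$ and $H$ are isoclinic if there are isomorphisms $\varphi:G/\mathbf{Z}(G)\to H/\mathbf{Z}(H)$ and $\phi:G'\to H'$ such that whenever $\varphi(g_1\mathbf{Z}(G))=h_1\mathbf{Z}(H)$ and $\varphi(g_2\mathbf{Z}(G))=h_2\mathbf{Z}(H)$, one has $\phi([g_1,g_2])=[h_1,h_2]$. Here $\mathbf{Z}(G)$ is the center and $G'$ the derived (commutator) subgroup of $G$. $\mathrm{S}_3$ is the symmetric group of degree $3$ and $D_{10}$ is the dihedral group of order $10$. *)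

(* Defs.v *)
From HB Require Import structures.
From mathcomp Require Import all_boot all_order all_algebra.
From mathcomp Require Import all_fingroup all_solvable all_field all_character.

Set Implicit Arguments.
Unset Strict Implicit.
Unset Printing Implicit Defensive.

Import GroupScope.

(* [~ x, y] is x^-1 * y^-1 * x * y. The other convention x * y * x^-1 * y^-1  *)
(* gives the same relation, being [~ x^-1, y^-1].                             *)
Definition isoclinic (gT hT : finGroupType) (G : {group gT}) (H : {group hT}) :
  Prop :=
  exists (phi : {morphism (G / 'Z(G)) >-> coset_of 'Z(H)})
         (psi : {morphism G^`(1) >-> hT}),
  [/\ isom (G / 'Z(G)) (H / 'Z(H)) phi,
      isom G^`(1) H^`(1) psi
    & forall g1 g2 h1 h2, g1 \in G -> g2 \in G -> h1 \in H -> h2 \in H ->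
        phi (coset 'Z(G) g1) = coset 'Z(H) h1 ->
        phi (coset 'Z(G) g2) = coset 'Z(H) h2 ->
        psi [~ g1, g2] = [~ h1, h2]].

Definition isoclinic_to_pgroup (p : nat) (gT : finGroupType) (G : {group gT}) :
  Prop :=
  exists (hT : finGroupType) (H : {group hT}), p.-group H /\ isoclinic G H.

Definition sum_irr_degrees (gT : finGroupType) (G : {group gT}) : algC :=
  (\sum_(i : Iirr G) 'chi[G]_i 1%g)%R.

(* Main.v *)
Require Import Defs.
From HB Require Import structures.
From mathcomp Require Import all_boot all_order all_algebra.
From mathcomp Require Import all_fingroup all_solvable all_field all_character.
From mathcomp Require Import zify.
Import GRing.Theory Num.Theory.

(* Nonlinear irreducible characters have degree at least 2 and there are       *)
(* |G : G'| linear ones, so 2 T(G) <= |G| + |G : G'|; with the hypothesis this *)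
(* forces |G'| <= 4.                                                           *)
(*   If Z(G) meets G' nontrivially, then (G / Z(G))' has order at most 2, so G *)
(* is nilpotent and is isoclinic to its Sylow p-subgroup for the prime p       *)
(* dividing |G'|. Otherwise G is isoclinic to G / Z(G), and |G'| is 3 or 4. If *)
(* |G'| = 3, the three subgroup lemma makes C_G(G') abelian, which gives       *)
(* |G / Z(G)| = 6. If |G'| = 4, then G permutes the nontrivial elements of G'  *)
(* transitively, all nonlinear degrees are at least 3, and T(G) <= |G| / 2.    *)

Import GroupScope.

(** Write g for the order of G'. If all nonlinear degrees are at least m + 1, [sum_irr_degrees_le]
    gives T(G) / |G| <= (g + m) / ((m + 1) g). For m = 1 this is 5/8 at g = 4 and 3/5 at g = 5, on
    either side of sqrt(3/8); for m = 2 and g = 4 it is 1/2, which [irr1_ge_card_class] turns into a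
    contradiction. Every isoclinism comes from [isoclinic_morphim]: a quotient whose kernel avoids
    G' is isoclinic to G. *)

(** * Isoclinism through quotients *)

(** A commutator killed by [f] is trivial. Hence the kernel is central, the preimage of the centre
    is the centre, and [f] is injective on G'; the two required isomorphisms are induced by [f]. *)
Lemma isoclinic_morphim (gT hT : finGroupType) (G : {group gT})
    (f : {morphism G >-> hT}) :
  'ker f :&: G^`(1) = 1 -> isoclinic G (f @* G)%G.
Proof.
move=> tiKG'.
have fR x y : x \in G -> y \in G -> f [~ x, y] = 1 -> [~ x, y] = 1.
  move=> Gx Gy fxy1; have: [~ x, y] \in 'ker f :&: G^`(1).
    by rewrite inE mem_commg // andbT; apply/kerP; rewrite ?groupR.
  by rewrite tiKG' => /set1P.
have sKZ: 'ker f \subset 'Z(G).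
  apply/subsetP=> x Kx; have Gx := dom_ker Kx.
  apply/centerP; split=> // y Gy; apply/commgP/eqP/fR => //.
  by rewrite morphR // (mker Kx) comm1g.
have fZ: f @* 'Z(G) = 'Z(f @* G).
  apply/setP=> u; apply/idP/idP.
    case/morphimP=> z Gz /centerP[_ cGz] ->; apply/centerP.
    split=> [|_ /morphimP[y Gy _ ->]]; first exact: mem_morphim.
    by apply/commgP; rewrite -morphR // (eqP (introT commgP (cGz y Gy))) morph1.
  case/centerP=> /morphimP[x Gx _ ->] cfx; rewrite mem_morphim //.
  apply/centerP; split=> // y Gy; apply/commgP/eqP/fR => //.
  by rewrite morphR //; apply/eqP/commgP/cfx/mem_morphim.
have injq : 'injm (quotm f (center_normal G)).
  rewrite ker_quotm quotient_sub1 //.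
  by rewrite (subset_trans sKZ) // (subset_trans (center_sub G)) ?normal_norm ?center_normal.
have isoq : isom (G / 'Z(G)) (f @* G / f @* 'Z(G)) (quotm f (center_normal G)).
  by apply: sub_isom => //; rewrite morphim_quotm.
have injG' : 'injm (restrm (der_sub 1 G) f).
  by rewrite ker_restrm setIC tiKG'.
pose psi := restrm_morphism (der_sub 1 G) f.
rewrite /isoclinic /= -fZ.
exists (quotm_morphism f (center_normal G)), psi; split=> //.
  by apply: sub_isom => //; rewrite morphim_restrm setIid morphim_der.
move=> g1 g2 _ _ Gg1 Gg2 /morphimP[k1 Gk1 _ ->] /morphimP[k2 Gk2 _ ->].
rewrite /= !quotmE //.
have nZ k : k \in G -> f k \in 'N(f @* 'Z(G)).
  move=> Gk; rewrite (subsetP (normal_norm (morphim_normal f (center_normal G)))) //.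
  exact: mem_morphim.
(* [g] and [k] have the same image up to a central factor, which drops out of commutators. *)
have center_eq g k : g \in G -> k \in G ->
    coset (f @* 'Z(G)) (f g) = coset (f @* 'Z(G)) (f k) ->
  exists2 z, z \in 'Z(G) & f g = f (z * k).
  move=> Gg Gk /rcoset_kercosetP => /(_ (nZ _ Gg) (nZ _ Gk)).
  case/rcosetP=> _ /morphimP[z Gz Zz ->] ->; exists z => //.
  by rewrite morphM.
case/center_eq => // z1 Zz1 e1; case/center_eq => // z2 Zz2 e2.
move/centerP: Zz1 => [Gz1 cz1]; move/centerP: Zz2 => [Gz2 cz2].
have c1 y z : (forall x, x \in G -> commute z x) -> y \in G -> [~ z, y] = 1.
  by move=> cz Gy; apply/eqP/commgP/cz.
have c2 y z : (forall x, x \in G -> commute z x) -> y \in G -> [~ y, z] = 1.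
  by move=> cz Gy; apply/eqP; rewrite -invg_comm invg_eq1 c1.
change (f [~ g1, g2] = [~ f k1, f k2]).
rewrite [LHS]morphR // e1 e2 -!morphR ?groupM //.
by congr (f _); rewrite commMgJ (c1 _ z1) ?groupM // conj1g mul1g commgMJ (c2 _ z2) // conj1g mulg1.
Qed.

(** Factoring out the p'-core leaves a p-group, and this core meets the p-group G' trivially. *)
Lemma isoclinic_nilpotent_der_pgroup (p : nat) (gT : finGroupType)
    (G : {group gT}) :
  nilpotent G -> p.-group G^`(1) -> isoclinic_to_pgroup p G.
Proof.
move=> nilG pG'.
have nsK := pcore_normal p^' G.
exists (coset_of 'O_p^'(G)), (G / 'O_p^'(G))%G; split.
  have /dprodP[_ defG _ _] := nilpotent_pcoreC p nilG.
  by rewrite /= -[in X in X / _]defG quotientMidr quotient_pgroup ?pcore_pgroup.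
have -> : (G / 'O_p^'(G))%G
    = (restrm (normal_norm nsK) (coset 'O_p^'(G)) @* G)%G.
  by apply/group_inj; rewrite /= morphim_restrm setIid.
apply: isoclinic_morphim.
rewrite ker_restrm ker_coset.
apply/coprime_TIg; rewrite coprime_sym.
apply: (pnat_coprime pG').
by apply: (pgroupS (subsetIr _ _)); apply: pcore_pgroup.
Qed.

Lemma isoclinic_quotient_center (gT hT : finGroupType) (G : {group gT})
    (H : {group hT}) :
  'Z(G) :&: G^`(1) = 1 -> G / 'Z(G) \isog H -> isoclinic G H.
Proof.
move=> tiZG' /isogP[f injf fG].
have sGD : G \subset 'dom (f \o coset 'Z(G)).
  by rewrite -sub_morphim_pre ?subxx // normal_norm ?center_normal.
have -> : H = (restrm sGD (f \o coset 'Z(G)) @* G)%G.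
  apply/group_inj; rewrite /= morphim_restrm setIid morphim_comp.
  by rewrite -fG.
apply: isoclinic_morphim; rewrite ker_restrm -[RHS]tiZG' ker_comp.
have /trivgP-> := injf; rewrite -kerE ker_coset.
by rewrite (setIidPr (center_sub G)).
Qed.

Lemma normal_card2_center (gT : finGroupType) (G N : {group gT}) :
  N <| G -> #|N| <= 2 -> N \subset 'Z(G).
Proof.
case/andP=> sNG nNG N2; apply/subsetP=> x Nx; apply/centerP.
split=> [|y Gy]; first exact: (subsetP sNG).
have [-> | ntx] := eqVneq x 1; first exact/commute_sym/commute1.
have NJ : x ^ y \in N by rewrite memJ_norm ?(subsetP nNG).
have ntJ : x ^ y != 1 by rewrite conjg_eq1.
apply/commgP/conjg_fixP/eqP; apply: contraTT N2 => neq.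
rewrite -ltnNge; apply: leq_trans (subset_leq_card (_ : [set 1; x; x ^ y] \subset N)).
  by rewrite setUC cardsU1 cards2 !inE (negPf ntJ) (negPf neq) eq_sym (negPf ntx).
by apply/subsetP=> z; rewrite !inE -orbA => /or3P[] /eqP->.
Qed.

(** The derived subgroup of G / Z(G) has order |G'| / |G' :&: Z(G)| <= 2, so it is central and G /
    Z(G) has class at most 2. *)
Lemma nilpotent_der_meet_center (gT : finGroupType) (G : {group gT}) :
  #|G^`(1)| <= 4 -> 'Z(G) :&: G^`(1) != 1 -> nilpotent G.
Proof.
move=> G'4 ntZ; rewrite -quotient_center_nil.
have nZ : G^`(1) \subset 'N('Z(G)).
  by rewrite (subset_trans (der_sub 1 G)) ?normal_norm ?center_normal.
apply: small_nil_class; apply: leq_trans (_ : 2 <= _) => //.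
rewrite nil_class2 normal_card2_center ?der_normal //.
rewrite /= -(quotient_der 1 (normal_norm (center_normal G))).
rewrite card_quotient //= -divgI setIC leq_divLR ?cardSg ?subsetIr //.
apply: (leq_trans G'4); apply: (@leq_mul 2 2) => //.
by rewrite cardG_gt1.
Qed.

(** * Derived subgroup of order 3 *)

(** An involution [t] must invert an element [g] of order 3, so [t] and [t * g] are distinct
    involutions generating G. *)
Lemma nonabelian_card6_isog_D6 (gT : finGroupType) (G : {group gT}) :
  #|G| = 6 -> ~~ abelian G -> G \isog 'D_6.
Proof.
move=> oG nabG.
have [t Gt ot] : {t | t \in G & #[t] = 2} by apply: Cauchy; rewrite ?oG.
have [g Gg og] : {g | g \in G & #[g] = 3} by apply: Cauchy; rewrite ?oG.
have gen_tg (H : {group gT}) : H \subset G -> t \in H -> g \in H -> H :=: G.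
  move=> sHG Ht Hg; apply/eqP; rewrite eqEcard sHG oG dvdn_leq ?cardG_gt0 //.
  have H2 : 2 %| #|H| by rewrite -ot order_dvdG.
  have H3 : 3 %| #|H| by rewrite -og order_dvdG.
  by rewrite (@Gauss_dvd 2 3) // H2.
have nsg : <[g]> <| G.
  apply: index2_normal; rewrite ?cycle_subG //.
  by rewrite -divgS ?cycle_subG // oG -orderE og.
have ntJ : g ^ t != g.
  apply: contra nabG => /eqP/conjg_fixP/commgP cgt.
  rewrite -(gen_tg (<[g]> <*> <[t]>)%G) /=.
  - by rewrite abelianY !cycle_abelian /= cent_cycle cycle_subG; apply/cent1P.
  - by rewrite join_subG !cycle_subG Gg.
  - by rewrite (subsetP (joing_subr _ _)) ?cycle_id.
  - by rewrite (subsetP (joing_subl _ _)) ?cycle_id.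
have gJ : g ^ t = g^-1.
  have: g ^ t \in <[g]> by rewrite memJ_norm ?cycle_id // (subsetP (normal_norm nsg)).
  case/cycleP=> k; rewrite -(expg_mod_order g k) og.
  have: k %% 3 < 3 by rewrite ltn_mod.
  case: (k %% 3) => [|[|[|]]] //= _ gt_k.
  - by move/eqP: gt_k; rewrite conjg_eq1 -order_eq1 og.
  - by rewrite gt_k eqxx in ntJ.
  - by apply/eqP; rewrite gt_k eq_sym eq_invg_mul -expgS -og expg_order.
have otg : #[t * g] = 2.
  have tV : t^-1 = t by apply/eqP; rewrite eq_invg_mul -[t * t]/(t ^+ 2) -ot expg_order.
  apply: nt_prime_order => //.
    by rewrite expgS expg1 -mulgA (mulgA g) -{1}tV mulgA -/(g ^ t) gJ mulVg.
  by apply/eqP=> /eqP; rewrite -eq_invg_mul => /eqP tVg; move: og; rewrite -tVg orderV ot.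
have ne_t_tg : t != t * g.
  by apply/eqP=> /(canLR (mulKg t)); rewrite mulVg => g1; move: og; rewrite -g1 order1.
have := involutions_gen_dihedral ot otg ne_t_tg.
rewrite /= (gen_tg (generated_group [set t; t * g])) ?oG //.
- by rewrite gen_subG subUset !sub1set Gt groupM.
- by rewrite mem_gen // set21.
by rewrite -[X in X \in _](mulKg t) groupM ?groupV ?mem_gen ?set21 ?set22.
Qed.

Lemma nonabelian_card6_isog_S3 (gT : finGroupType) (G : {group gT}) :
  #|G| = 6 -> ~~ abelian G -> G \isog [set: 'S_3].
Proof.
move=> oG nabG; apply: isog_trans (nonabelian_card6_isog_D6 _ _ oG nabG) _.
rewrite isog_sym; apply: nonabelian_card6_isog_D6.
  by rewrite cardsT card_Sn.
apply/negP => /centsP cS.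
pose a : 'I_3 := inord 0; pose b : 'I_3 := inord 1; pose c : 'I_3 := inord 2.
(* The two products of these transpositions send [a] to [c] and to [b] respectively. *)
have /permP/(_ a) := cS (tperm a b) (in_setT _) (tperm b c) (in_setT _).
rewrite !permM tpermL tpermL (@tpermD _ b c a) ?tpermL.
  by move/(congr1 val); rewrite /= !inordK.
all: by rewrite -val_eqE /= !inordK.
Qed.

Lemma cent_der_abelian (gT : finGroupType) (G : {group gT}) :
  'Z(G) :&: G^`(1) = 1 -> abelian 'C_G(G^`(1)).
Proof.
move=> tiZG'; set C := 'C_G(_).
have sCG : C \subset G := subsetIl _ _.
have CG1 : [~: G, C, C] = 1.
  by apply/commG1P; rewrite (subset_trans (commgS G sCG)) // centsC subsetIr.
have CCG1 : [~: C, C, G] = 1.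
  by apply: three_subgroup; rewrite // [[~: C, G]]commGC.
have sCCG' : [~: C, C] \subset G^`(1) by rewrite commgSS.
apply/commG1P/trivgP; rewrite -tiZG' !subsetI sCCG' (subset_trans sCCG') ?der_sub //=.
by rewrite andbT; apply/commG1P.
Qed.

(** With C the centralizer of G', the index is |G : C| |C : Z(G)| = 2 * 3. The factor 2 counts the
    conjugates of a generator of G'; the factor 3 counts the C-conjugates of an element outside
    C. *)
Lemma index_center_der_card3 (gT : finGroupType) (G : {group gT}) :
  #|G^`(1)| = 3 -> 'Z(G) :&: G^`(1) = 1 -> #|G : 'Z(G)| = 6.
Proof.
move=> oG' tiZG'; set C := 'C_G(G^`(1)).
have cCC : abelian C := cent_der_abelian _ _ tiZG'.
have cycG' : cyclic G^`(1) by rewrite prime_cyclic ?oG'.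
have sCG : C \subset G := subsetIl _ _.
have sG'C : G^`(1) \subset C by rewrite subsetI der_sub -abelianE cyclic_abelian.
have sZC : 'Z(G) \subset C by rewrite setIS // centS // der_sub.
have iGC : #|G : C| = 2.
  case/cyclicP: cycG' => g defG'.
  have G'g : g \in G^`(1) by rewrite defG' cycle_id.
  have ntg : g != 1 by apply: contra_eq_neq oG' => g1; rewrite defG' g1 cycle1 cards1.
  rewrite /C defG' cent_cycle index_cent1; apply/eqP; rewrite eqn_leq; apply/andP; split.
    have -> : 2 = #|G^`(1)^#| by rewrite (cardsD1 1) group1 in oG'; case: oG'.
    apply/subset_leq_card/subsetP=> _ /imsetP[y Gy ->].
    by rewrite !inE conjg_eq1 ntg memJ_norm // (subsetP (der_norm 1 G)).
  rewrite -index_cent1 indexg_gt1; apply: contra ntg => sGC.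
  have : g \in 'Z(G) :&: G^`(1).
    rewrite !inE G'g (subsetP (der_sub 1 G)) //= andbT.
    by rewrite -sub_cent1 (subset_trans sGC) ?subsetIr.
  by rewrite tiZG' => /set1P->.
have [x Gx nCx] : exists2 x, x \in G & x \notin C.
  by apply/subsetPn; rewrite -indexg_gt1 iGC.
(* If [c] in the abelian group C commutes with [x], its centralizer properly contains C, of index 2,
   so it is all of G. *)
have defZ : 'C_C[x] = 'Z(G).
  apply/eqP; rewrite eqEsubset; apply/andP; split; last first.
    by rewrite subsetI sZC /= sub_cent1 (subsetP _ _ Gx) // centsC subsetIr.
  apply/subsetP=> c /setIP[Cc cxc]; rewrite inE (subsetP sCG) //=.
  rewrite -sub_cent1; apply/setIidPl; apply/eqP.
  have sCD : C \subset 'C_G[c] by rewrite subsetI sCG sub_cent1 (subsetP cCC).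
  have := Lagrange_index (subsetIl G 'C[c]) sCD.
  rewrite iGC => /eqP; rewrite eqEsubset subsetIl /=.
  have : 1 < #|'C_G[c] : C|.
    rewrite indexg_gt1; apply: contra nCx => /subsetP; apply.
    by rewrite inE Gx cent1C.
  rewrite -indexg_eq1.
  by move: #|_ : _| #|_ : _| => m n; move/eqP; nia.
(* The C-conjugates of [x] lie in the coset of G' by [x], so the index is at most 3; the direct
   product of Z(G) and G' lies in C, so 3 divides it. *)
have iCZ : #|C : 'Z(G)| = 3.
  apply/eqP; rewrite eqn_leq; apply/andP; split.
    rewrite -defZ index_cent1 -oG' -(card_lcoset _ x).
    apply/subset_leq_card/subsetP=> _ /imsetP[c Cc ->].
    by rewrite mem_lcoset -commgEl mem_commg // (subsetP sCG).
  rewrite dvdn_leq // -oG'.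
  rewrite -divgS // dvdn_divRL ?cardSg //.
  rewrite -TI_cardMg 1?setIC // -norm_joinEl ?cardSg ?join_subG ?sG'C //.
  by rewrite (subset_trans (der_sub 1 G)) ?normal_norm ?center_normal.
by rewrite -(Lagrange_index sCG sZC) iGC iCZ.
Qed.

Lemma isoclinic_S3 (gT : finGroupType) (G : {group gT}) :
  #|G^`(1)| = 3 -> 'Z(G) :&: G^`(1) = 1 -> isoclinic G [set: 'S_3]%G.
Proof.
move=> oG' tiZG'; apply: isoclinic_quotient_center => //.
apply: nonabelian_card6_isog_S3.
  by rewrite card_quotient ?normal_norm ?center_normal // index_center_der_card3.
(* In a nilpotent group the nontrivial normal subgroup G' would meet the centre. *)
apply/negP=> /abelian_nil; rewrite quotient_center_nil => nilG.
have := TI_center_nil nilG (der_normal 1 G); rewrite setIC => /(_ tiZG') G'1.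
by move: oG'; rewrite G'1 cards1.
Qed.

(** * Character degrees *)

(** Termwise comparison with the sum of squared degrees: a nonlinear degree d satisfies (m + 1) d <=
    d ^ 2, and each linear character costs an extra m. *)
Lemma sum_irr_degrees_le (gT : finGroupType) (G : {group gT}) (m : nat) :
  (forall i : Iirr G, 'chi_i \isn't a linear_char -> m.+1%:R <= 'chi_i 1%g)%R ->
  (m.+1%:R * sum_irr_degrees G <= #|G|%:R + m%:R * #|G : G^`(1)|%:R)%R.
Proof.
move=> ge_m; rewrite -irr_sum_square -card_lin_irr -sum1_card natr_sum.
rewrite !mulr_sumr [X in (_ <= _ + X)%R]big_mkcond -big_split /=.
apply: ler_sum => i _; rewrite inE; case: ifPn => [/lin_char1-> | /ge_m le_m].
  by rewrite expr1n !mulr1 -natr1 addrC.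
by rewrite addr0 expr2 ler_wpM2r // char1_ge0 ?irr_char.
Qed.

(* [chi] sums to 0 over [N] and is constant on [N^#], hence equal there to the *)
(* rational algebraic integer [- chi 1 / #|N|.-1].                             *)
Lemma irr1_ge_card_class (gT : finGroupType) (G N : {group gT}) (x : gT)
    (i : Iirr G) :
  N <| G -> x ^: G = N^# -> ~~ (N \subset cfker ('chi_i)%R) ->
  (#|N|.-1%:R <= 'chi_i 1%g)%R.
Proof.
move=> nsNG defxG kerN; have sNG := normal_sub nsNG.
(* The sum is |N| times the multiplicity of the trivial character in the restriction, which is zero
   unless N lies in the kernel. *)
have sum0 : (\sum_(y in N) 'chi_i y = 0)%R.
  have : '['Res[N] 'chi_i, 'chi_0]%R = 0%R.
    apply/eqP; apply: contraR kerN => nz.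
    by apply: constt0_Res_cfker; rewrite // irr_consttE.
  rewrite cfdotE => /eqP; rewrite mulf_eq0 invr_eq0 pnatr_eq0 eqn0Ngt cardG_gt0 /=.
  move/eqP=> eq0; rewrite -[RHS]eq0; apply: eq_bigr => y Ny.
  by rewrite irr0 cfun1E Ny conjC1 mulr1 cfResE.
have cN : (#|N^#|%:R * 'chi_i x = - 'chi_i 1%g)%R.
  apply/eqP; rewrite -addr_eq0 -[X in _ == X]sum0 (big_setD1 1%g) //= addrC.
  rewrite -sum1_card natr_sum mulr_suml; apply/eqP; congr (_ + _)%R.
  apply: eq_bigr => y; rewrite -defxG => /imsetP[z Gz ->].
  by rewrite mul1r cfunJ.
have -> : #|N|.-1 = #|N^#| by rewrite (cardsD1 1%g N) group1.
have [-> | n_gt0] := posnP #|N^#|; first by rewrite char1_ge0 ?irr_char.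
have nz : (#|N^#|%:R != 0 :> algC)%R by rewrite pnatr_eq0 -lt0n.
have chi_x : ('chi_i x = - 'chi_i 1%g / #|N^#|%:R)%R by rewrite -cN mulrC mulKf.
have int_x : ('chi_i x \in Num.int)%R.
  apply: Cint_rat_Aint (Aint_irr i x).
  by rewrite chi_x rpred_div ?rpredN ?rpred_nat //= irr1_degree rpred_nat.
have nz_x : ('chi_i x != 0)%R.
  by rewrite chi_x mulf_neq0 ?invr_eq0 // oppr_eq0 irr1_neq0.
(* A nonzero integer has absolute value at least 1, and the degree is [#|N^#|] times that of
   ['chi_i x]. *)
rewrite -(ger0_norm (char1_ge0 (irr_char i))) -normrN -cN normrM normr_nat.
by rewrite ler_peMr ?ler0n // norm_intr_ge1.
Qed.

(* A class of [G] inside [G^`(1)^#] has at least two elements, so if there were *)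
(* a second one they would fill more than three elements.                      *)
Lemma der_card4_class (gT : finGroupType) (G : {group gT}) :
  #|G^`(1)| = 4 -> 'Z(G) :&: G^`(1) = 1 ->
  exists x : gT, x ^: G = G^`(1)^#.
Proof.
move=> oG' tiZG'.
have o3 : #|G^`(1)^#| = 3 by rewrite (cardsD1 1 G^`(1)) group1 in oG'; case: oG'.
have sub_class x : x \in G^`(1)^# -> x ^: G \subset G^`(1)^#.
  by rewrite class_sub_norm // normD1 der_norm.
have class_gt1 x : x \in G^`(1)^# -> 1 < #|x ^: G|.
  case/setD1P=> ntx G'x; rewrite -index_cent1 indexg_gt1; apply: contra ntx => sGC.
  have : x \in 'Z(G) :&: G^`(1).
    rewrite !inE G'x (subsetP (der_sub 1 G)) //= andbT.
    by rewrite -sub_cent1 (subset_trans sGC) ?subsetIr.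
  by rewrite tiZG' => /set1P->.
have /card_gt0P[x G'x] : 0 < #|G^`(1)^#| by rewrite o3.
exists x; apply/eqP; rewrite eqEsubset sub_class //=.
apply/subsetPn=> -[y G'y nxy]; have: 3 < #|x ^: G :|: y ^: G|.
  rewrite cardsU disjoint_setI0 ?cards0 ?subn0 ?(leq_add (class_gt1 x _) (class_gt1 y _)) //.
  rewrite -setI_eq0; apply: contraR nxy => /set0Pn[z /setIP[xz yz]].
  by rewrite -(class_eqP xz) class_sym.
by rewrite ltnNge -o3 subset_leq_card // subUset !sub_class.
Qed.

Theorem theorem3 (gT : finGroupType) (G : {group gT}) :
  (sqrtC (3%:R / 8%:R) * #|G|%:R < sum_irr_degrees G)%R ->
  abelian G \/
  isoclinic_to_pgroup 2 G \/
  isoclinic_to_pgroup 3 G \/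
  isoclinic G [set: 'S_3]%G \/
  isoclinic G 'D_10%G.
Proof.
move=> bigT.
set g := #|G^`(1)|; set a := #|G : G^`(1)|.
have oG : #|G| = (g * a)%N by rewrite Lagrange ?der_sub.
(* Divide the degree bound by |G : G'|, compare with the hypothesis, and square to remove the
   root. *)
have lt_sq m : (forall i : Iirr G, 'chi_i \isn't a linear_char ->
     m.+1%:R <= 'chi_i 1%g)%R ->
   (3 * (m.+1 * g) ^ 2 < 8 * (g + m) ^ 2)%N.
  move/sum_irr_degrees_le; set s : algC := sqrtC _ in bigT.
  have s_ge0 : (0 <= s)%R by rewrite sqrtC_ge0 divr_ge0 ?ler0n.
  have a_gt0 : (0 < a%:R :> algC)%R by rewrite ltr0n indexg_gt0.
  rewrite -(ltr_pM2l (ltr0Sn algC m)) in bigT.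
  move/(Order.POrderTheory.lt_le_trans bigT); rewrite oG natrM -mulrDl !mulrA ltr_pM2r //.
  rewrite -natrD -(ltr_pXn2r (n := 2)) ?nnegrE ?ler0n ?mulr_ge0 ?ler0n //.
  rewrite [(_ * s)%R]mulrC -mulrA -natrM exprMn sqrtCK -mulrA mulrCA mulrC.
  rewrite ltr_pdivrMr ?ltr0n // -!natrX -!natrM ltr_nat mulnC.
  by rewrite [in X in _ < X]mulnC.
(* With m = 1 the inequality is 12 g^2 < 8 (g + 1)^2, which fails from g = 5 on. *)
have le4 : g <= 4.
  have/lt_sq: (forall i : Iirr G, 'chi_i \isn't a linear_char -> 2%:R <= 'chi_i 1%g)%R.
    move=> i; rewrite qualifE /= irr_char irr1_degree.
    rewrite pnatr_eq1 ler_nat => ne1.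
    by rewrite ltn_neqAle eq_sym ne1 irr_degree_gt0.
  by clear; nia.
have [G'1 | ntG'] := eqVneq G^`(1) 1; first by left; apply/derG1P.
have G'gt1 : 1 < g by rewrite /g cardG_gt1.
have g_cases : [\/ g = 2, g = 3 | g = 4].
  by case: (g) le4 G'gt1 => [|[|[|[|[|n]]]]] // _ _; [constructor 1 | constructor 2 | constructor 3].
right; have [tiZG' | ntZ] := eqVneq ('Z(G) :&: G^`(1)) 1; last first.
  have nilG := nilpotent_der_meet_center _ _ le4 ntZ.
  by case: g_cases => oG'; [left | right; left | left];
     apply: isoclinic_nilpotent_der_pgroup; rewrite // /pgroup -/g oG'.
case: g_cases => oG'.
- case/eqP: ntG'; rewrite -tiZG'; apply/esym/setIidPr.
  by rewrite normal_card2_center ?der_normal // -/g oG'.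
- by right; right; left; apply: isoclinic_S3.
have [x class_x] := der_card4_class _ _ oG' tiZG'.
(* With m = 2 and g = 4 the inequality would read 432 < 288. *)
have/lt_sq: (forall i : Iirr G, 'chi_i \isn't a linear_char -> 3%:R <= 'chi_i 1%g)%R.
  move=> i; rewrite lin_irr_der1 => kerG'.
  by have := irr1_ge_card_class _ _ _ _ i (der_normal 1 G) class_x kerG'; rewrite -/g oG'.
by rewrite oG'.
Qed.
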